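(* Let $A=C_L^\top C_L$ and let $S=[S_0,S_1,\dots,S_L]$ be the BPX scaling operator (horizontal concatenation), with $C_L$ and $S_\ell$ as defined in the context. Then the preconditioned matrix $A_S=S^\top A S=(C_LS)^\top(C_LS)$ admits an exact (square) block-encoding with normalization $$\alpha_{A_S}:=\alpha_{CS}^2=\mathcal{O}\bigl(d^2(L+1)\bigr),$$ where $\alpha_{CS}$ is the normalization of an exact generalized block-encoding of $C_LS$, and the implied constant is independent of $d$ and $L$.
   Context: Grids: $d\ge1$, $h_\ell:=2^{-\ell}$ for $\ell=0,\dots,L$, $h:=h_L$. The space of interior grid functions on level $\ell$ is $V_\ell=\mathbb{R}^{(2^\ell-1)^d}\cong(\mathbb{R}^{2^\ell-1})^{\otimes d}$. Difference operators: for $\bm u=(u_1,\dots,u_{2^L-1})^\top$, extended by $u_0=u_{2^L}=0$, $(D_L^{1d}\bm u)_j=u_{j+1}-u_j$, $j=0,\dots,2^L-1$. $D_L^{(k)}:=I^{\otimes(k-1)}\otimes D_L^{1d}\otimes I^{\otimes(d-k)}$ with $I$ the identity of size $2^L-1$; $D_L:=[(D_L^{(1)})^\top,\dots,(D_L^{(d)})^\top]^\top$ and $C_L:=h^{d/2-1}D_L$. The matrix $A=C_L^\top C_L$ is the finite difference stiffness matrix of the Poisson problem with homogeneous Dirichlet condition on $[0,1]^d$, scaled by $h^{d-2}$ (diagonal entries $2d\,h^{d-2}$, nearest-neighbour entries $-h^{d-2}$). Prolongation: $P^{1d}_{\ell\to\ell+1}\in\mathbb{R}^{(2^{\ell+1}-1)\times(2^\ell-1)}$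 maps $\bm v$ to $\bm w$ with $w_{2q}=v_q$ ($q=1,\dots,2^\ell-1$) and $w_{2q-1}=\tfrac12(v_{q-1}+v_q)$ ($q=1,\dots,2^\ell$), where $v_0=v_{2^\ell}=0$. $P_\ell^{1d}:=P^{1d}_{L-1\to L}\cdots P^{1d}_{\ell\to\ell+1}$ (identity if $\ell=L$), $P_\ell:=(P_\ell^{1d})^{\otimes d}$, $S_\ell:=h_\ell^{(2-d)/2}P_\ell$. The BPX preconditioner is $B=SS^\top=\sum_{\ell=0}^L h_\ell^{2-d}P_\ell P_\ell^\top$. Block-encoding: let $M\in\mathbb{C}^{N\times N}$, $N\le 2^n$ (zero-padded to size $2^n$ if $N<2^n$), and $\Pi:=\langle 0^m|\otimes I_n$, where $I_n$ is the $n$-qubit identity. A unitary $U$ on $m+n$ qubits is an $(\alpha,m,\varepsilon)$-block-encoding of $M$ if $\|M-\alpha\,\Pi U\Pi^\dagger\|\le\varepsilon$, $\alpha\ge\|M\|$ (operator norm). It is exact if $\varepsilon=0$; $\alpha$ is the normalization. Generalized block-encoding: let $K\in\mathbb{C}^{M_2\times M_1}$ with $M_1,M_2\le 2^m$, and let $\Pi_1:\mathbb{C}^{2^m}\to\mathbb{C}^{M_1}$, $\Pi_2:\mathbb{C}^{2^m}\to\mathbb{C}^{M_2}$ be orthogonal projectors onto subspaces identified with $\mathbb{C}^{M_1},\mathbb{C}^{M_2}$ (i.e. $\Pi_i\Pi_i^\dagger=I$). A unitary $U$ on $m$ qubits is a generalized $(\gamma,\varepsilon)$-block-encoding of $K$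 with respect to $(\Pi_1,\Pi_2)$ if $\gamma>0$ and $\|K-\gamma\,\Pi_2U\Pi_1^\dagger\|\le\varepsilon$; exact if $\varepsilon=0$; $\gamma$ is the normalization. *)

(* Defs.v *)
From HB Require Import structures.
From mathcomp Require Export all_boot all_order all_algebra.
From mathcomp Require Export complex mxtens.
From mathcomp Require Export spectral.
From mathcomp Require Export mathcomp_extra boolp classical_sets reals exp.

Set Implicit Arguments.
Unset Strict Implicit.
Unset Printing Implicit Defensive.

Import Order.TTheory GRing.Theory Num.Theory.

Local Open Scope ring_scope.
Local Open Scope classical_set_scope.
Local Open Scope complex_scope.
Local Open Scope sesquilinear_scope.

Definition l2norm (R : realType) n (v : 'cV[R[i]]_n) : R :=
  Num.sqrt (\sum_(j < n) Normc.normc (v j 0) ^+ 2).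

Definition opnorm (R : realType) m n (M : 'M[R[i]]_(m, n)) : R :=
  sup [set l2norm (M *m v) | v in [set v : 'cV[R[i]]_n | l2norm v <= 1]].

Definition complexify (R : realType) m n (M : 'M[R]_(m, n)) : 'M[R[i]]_(m, n) :=
  map_mx (real_complex R) M.

(* <0^m|, the first standard basis row vector of C^(2^m) *)
Definition bra0 (R : realType) m : 'rV[R[i]]_(2 ^ m) :=
  \row_(j < 2 ^ m) ((j : nat) == 0)%:R.

(* <0^m| (x) I_n; the cast identifies the row index 1 * 2^n with 2^n. *)
Definition ancilla_proj (R : realType) m n : 'M[R[i]]_(2 ^ n, 2 ^ m * 2 ^ n) :=
  castmx (mul1n _, erefl) (bra0 R m *t (1%:M : 'M[R[i]]_(2 ^ n))).

(* pid_mx N is the embedding of C^N as the first N coordinates of C^(2^n). *)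
Definition zero_pad (R : realType) N n (M : 'M[R[i]]_N) : 'M[R[i]]_(2 ^ n) :=
  (pid_mx N : 'M_(2 ^ n, N)) *m M *m (pid_mx N : 'M_(N, 2 ^ n)).

(* The ancilla register of m qubits is the left tensor factor. *)
Definition block_encoding (R : realType) N (alpha : R) m (eps : R) n
    (U : 'M[R[i]]_(2 ^ m * 2 ^ n)) (M : 'M[R[i]]_N) : Prop :=
  [/\ (N <= 2 ^ n)%N, U \is unitarymx,
      opnorm (zero_pad n M
        - alpha%:C *: (ancilla_proj R m n *m U *m (ancilla_proj R m n) ^t*))
        <= eps
    & opnorm M <= alpha].

(* For rectangular Pi, [Pi \is unitarymx] says Pi *m Pi ^t* = 1%:M. *)
Definition gen_block_encoding (R : realType) M1 M2 (gamma eps : R) m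
    (Pi1 : 'M[R[i]]_(M1, 2 ^ m)) (Pi2 : 'M[R[i]]_(M2, 2 ^ m))
    (U : 'M[R[i]]_(2 ^ m)) (K : 'M[R[i]]_(M2, M1)) : Prop :=
  [/\ (M1 <= 2 ^ m)%N && (M2 <= 2 ^ m)%N,
      [/\ Pi1 \is unitarymx, Pi2 \is unitarymx & U \is unitarymx], 0 < gamma
    & opnorm (K - gamma%:C *: (Pi2 *m U *m Pi1 ^t*)) <= eps].

Definition meshsize (R : realType) (l : nat) : R := 2%:R ^- l.

(* Interior points per direction. The index i : 'I_(npts l) stands for the grid
   point i + 1; the values at the boundary points 0 and 2 ^ l are 0 and have no
   index. *)
Definition npts (l : nat) : nat := (2 ^ l - 1)%N.

(* Row j is the functional u |-> u_(j+1) - u_j. *)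
Definition diff1d (R : realType) (L : nat) : 'M[R]_(2 ^ L, npts L) :=
  \matrix_(j < 2 ^ L, i < npts L) ((i.+1 == j.+1)%:R - (i.+1 == j :> nat)%:R).

Lemma tens_dim (n d k : nat) : (k < d)%N ->
  (n ^ k * (n * n ^ (d - k.+1)) = n ^ d)%N.
Proof. by move=> kd; rewrite -expnS -expnD -addSnnS subnKC. Qed.

(* Directions are numbered from 0: k : 'I_d is the direction k + 1. *)
Definition diff_dir (R : realType) (d L : nat) (k : 'I_d) :
    'M[R]_(npts L ^ k * (2 ^ L * npts L ^ (d - k.+1)), npts L ^ d) :=
  castmx (erefl, tens_dim (npts L) (ltn_ord k))
    (ntensmx (1%:M : 'M[R]_(npts L)) k
     *t (diff1d R L *t ntensmx (1%:M : 'M[R]_(npts L)) (d - k.+1))).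

Definition diff_op (R : realType) (d L : nat) :
    'M[R]_(\sum_(k < d) npts L ^ k * (2 ^ L * npts L ^ (d - k.+1)),
           npts L ^ d) :=
  \mxcol_(k < d) @diff_dir R d L k.

Definition Cmat (R : realType) (d L : nat) :
    'M[R]_(\sum_(k < d) npts L ^ k * (2 ^ L * npts L ^ (d - k.+1)),
           npts L ^ d) :=
  (meshsize R L `^ (d%:R / 2%:R - 1)) *: diff_op R d L.

Definition Amat (R : realType) (d L : nat) : 'M[R]_(npts L ^ d) :=
  (Cmat R d L)^T *m Cmat R d L.

(* Fine point j = i + 1, coarse point q = k + 1: w_j = v_(j/2) for j even, and
   w_j = (v_((j-1)/2) + v_((j+1)/2)) / 2 for j odd. *)
Definition prol_step (R : realType) (l : nat) : 'M[R]_(npts l.+1, npts l) :=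
  \matrix_(i < npts l.+1, k < npts l)
    let j := i.+1 in let q := k.+1 in
    if odd j then ((q == j./2)%:R + (q == uphalf j)%:R) / 2%:R
    else (q == j./2)%:R.

Fixpoint prol_iter (R : realType) (l k : nat) : 'M[R]_(npts (k + l), npts l) :=
  if k is k'.+1 return 'M[R]_(npts (k + l), npts l)
  then prol_step R (k' + l) *m prol_iter R l k' else 1%:M.

Definition prol1d (R : realType) (L : nat) (l : 'I_L.+1) :
    'M[R]_(npts L, npts l) :=
  castmx (congr1 npts (subnK (leq_ord l)), erefl) (prol_iter R l (L - l)).

Definition prol (R : realType) (d L : nat) (l : 'I_L.+1) :
    'M[R]_(npts L ^ d, npts l ^ d) := ntensmx (prol1d R l) d.

Definition Slevel (R : realType) (d L : nat) (l : 'I_L.+1) :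
    'M[R]_(npts L ^ d, npts l ^ d) :=
  (meshsize R l `^ ((2%:R - d%:R) / 2%:R)) *: prol R d l.

Definition Smat (R : realType) (d L : nat) :
    'M[R]_(npts L ^ d, \sum_(l < L.+1) npts l ^ d) :=
  \mxrow_(l < L.+1) @Slevel R d L l.

Definition precondA (R : realType) (d L : nat) :
    'M[R]_(\sum_(l < L.+1) npts l ^ d) :=
  (Smat R d L)^T *m Amat R d L *m Smat R d L.

(* Main.v *)
Require Import Defs.
From mathcomp Require Import ring lra zify.

(** A matrix [K] with [norm K <= g] always has an exact block-encoding with
    normalization [g]: [K / g] is a contraction, and a contraction is a corner
    of a unitary of twice the size. So the theorem is a norm estimate,
    [norm (C_L S) ^ 2 <= 4 d (L + 1)], together with a dilation, and
    [alphaCS ^ 2 = 4 d (L + 1) <= 4 d ^ 2 (L + 1)]. The second encoding uses the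
    same estimate, since [A_S = (C_L S)^* (C_L S)] has norm at most
    [alphaCS ^ 2].

    Norm estimate. Fix a level [l], put [w = 2 ^ (L - l)], and consider one
    direction. The matrix [D^(k) P_l] is a tensor product of [d - 1] copies of
    the one-dimensional prolongation [P] and one copy of [D P]. The absolute row
    and column sums of [P] are at most [1] and [w], because it interpolates
    and each coarse hat function has mass [w] on the fine grid. Differences
    of a prolongated function are differences of the coarse function divided by
    [w] and repeated [w] times ([diff_prol_step] for [w = 2]), so those of
    [D P] are at most [2 / w] and [2]. Such sums multiply along tensor products,
    and the Schur test ([schur_test]) bounds the squared norm of [D^(k) P_l] by
    [(2 / w) * (2 * w ^ (d - 1)) = 4 * w ^ (d - 2)] without any constant
    exponential in [d]. The scalings in [C_L] and [S_l] contribute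
    [w ^ (2 - d)] ([scaling_sqr]), which leaves exactly [4] per direction. The
    [d] directions are stacked vertically, which adds squared norms; the
    [L + 1] levels are put side by side, which by Cauchy-Schwarz costs a factor
    [L + 1] ([bounded_by_CS]).

    Dilation. Let [T] and [T'] be the square roots of [1 - M^* M] and
    [1 - M M^*]. The Halmos matrix with rows [M, T'] and [T, - M^*] is unitary
    ([halmos_unitary]). The only nontrivial point is [T' M = M T], which follows
    from the corresponding identity for the squares because the square root of a
    diagonalizable matrix acts eigenvalue by eigenvalue
    ([sqrtmx_intertwine]). *)

Set Implicit Arguments.
Unset Strict Implicit.
Unset Printing Implicit Defensive.

Import Order.TTheory GRing.Theory Num.Theory.

Local Open Scope ring_scope.
Local Open Scope complex_scope.
Local Open Scope sesquilinear_scope.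

(** * The Schur test *)

Definition sqnorm (R : realType) n (v : 'cV[R]_n) : R := \sum_i v i 0 ^+ 2.

(** The bound [b] is on the square of the operator norm, so that it is
    additive over stacked blocks and involves no square roots. *)
Definition bounded_by (R : realType) m n (b : R) (A : 'M[R]_(m, n)) : Prop :=
  forall v, sqnorm (A *m v) <= b * sqnorm v.

(** Column sums are handled as row sums of the transpose. Keeping [0 <= r]
    in the predicate makes it stable under products even for matrices without
    rows. *)
Definition row_sums_le (R : realType) m n (A : 'M[R]_(m, n)) (r : R) : Prop :=
  0 <= r /\ forall i, \sum_j `|A i j| <= r.

Lemma row_sums_le_mul (R : realType) m n p (A : 'M[R]_(m, n)) (B : 'M[R]_(n, p))
    (a b : R) :
  row_sums_le A a -> row_sums_le B b -> row_sums_le (A *m B) (a * b).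
Proof.
move=> [a0 hA] [b0 hB]; split=> [|i]; first exact: mulr_ge0.
apply: (@le_trans _ _ (\sum_j \sum_k `|A i k| * `|B k j|)).
  apply: ler_sum => j _; rewrite mxE; apply: le_trans (ler_norm_sum _ _ _) _.
  by apply: ler_sum => k _; rewrite normrM.
rewrite exchange_big /=; apply: (@le_trans _ _ (\sum_k `|A i k| * b)).
  by apply: ler_sum => k _; rewrite -mulr_sumr ler_wpM2l.
by rewrite -mulr_suml ler_wpM2r.
Qed.

(** A row of [A *t B] consists of all products of an entry of a row of [A]
    and an entry of a row of [B], so its absolute sum factors. *)
Lemma row_sums_le_tens (R : realType) m n p q (A : 'M[R]_(m, n))
    (B : 'M[R]_(p, q)) (a b : R) :
  row_sums_le A a -> row_sums_le B b -> row_sums_le (A *t B) (a * b).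
Proof.
move=> [a0 hA] [b0 hB]; split=> [|i]; first exact: mulr_ge0.
case: (mxtens_indexP i) => i1 i2.
have -> : \sum_j `|(A *t B) (mxtens_index (i1, i2)) j| =
    (\sum_j `|A i1 j|) * (\sum_j `|B i2 j|).
  rewrite mulr_sum; apply: eq_bigr => j _.
  by case: (mxtens_indexP j) => j1 j2; rewrite tensmxE normrM mxtens_indexK.
by apply: ler_pM => //; apply: sumr_ge0.
Qed.

Lemma row_sums_le1 (R : realType) n : row_sums_le (1%:M : 'M[R]_n) 1.
Proof.
split=> // i; rewrite (bigD1 i) //= mxE eqxx normr1 big1 ?addr0 // => j ji.
by rewrite mxE eq_sym (negPf ji) normr0.
Qed.

Lemma row_sums_le_ntens (R : realType) m n (A : 'M[R]_(m, n)) (a : R) k :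
  row_sums_le A a -> row_sums_le (ntensmx A k) (a ^+ k).
Proof.
move=> hA; case: k => [|k]; first by rewrite expr0; exact: row_sums_le1.
rewrite /ntensmx; elim: k => [//|k IH] /=.
by rewrite exprS; apply: row_sums_le_tens.
Qed.

Lemma row_sums_le_cast (R : realType) m n p q (e : (m = p) * (n = q))
    (A : 'M[R]_(m, n)) (a : R) :
  row_sums_le A a -> row_sums_le (castmx e A) a.
Proof. by case: e => e1 e2; case: _ / e1; case: _ / e2. Qed.

Lemma row_sums_leZ (R : realType) m n (A : 'M[R]_(m, n)) (a s : R) :
  0 <= s -> row_sums_le A a -> row_sums_le (s *: A) (s * a).
Proof.
move=> s0 [a0 hA]; split=> [|i]; first exact: mulr_ge0.
under eq_bigr do rewrite mxE normrM ger0_norm //.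
by rewrite -mulr_sumr ler_wpM2l.
Qed.

(** Cauchy-Schwarz with weights; twice the difference of the two sides is
    [\sum_i \sum_j w i * w j * (x i - x j) ^+ 2]. *)
Lemma weighted_sum_sqr_le (R : realType) n (w x : 'I_n -> R) :
  (forall j, 0 <= w j) ->
  (\sum_j w j * x j) ^+ 2 <= (\sum_j w j) * (\sum_j w j * x j ^+ 2).
Proof.
move=> w0; rewrite -subr_ge0 -(pmulr_rge0 _ (ltr0n R 2)).
suff -> : 2%:R * ((\sum_j w j) * (\sum_j w j * x j ^+ 2)
    - (\sum_j w j * x j) ^+ 2)
    = \sum_i \sum_j w i * w j * (x i - x j) ^+ 2.
  by apply: sumr_ge0 => i _; apply: sumr_ge0 => j _;
    rewrite mulr_ge0 ?sqr_ge0 // mulr_ge0.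
have E (f g : 'I_n -> R) :
  (\sum_i f i) * (\sum_i g i) = \sum_i \sum_j f i * g j.
  by rewrite mulr_suml; apply: eq_bigr => i _; rewrite mulr_sumr.
rewrite mulrBr expr2 !E [X in X - _](_ : _ =
  \sum_i \sum_j w i * (w j * x j ^+ 2) + \sum_i \sum_j w j * (w i * x i ^+ 2)).
  rewrite mulr_sumr -big_split -sumrB /=; apply: eq_bigr => i _.
  rewrite mulr_sumr -big_split -sumrB /=; apply: eq_bigr => j _; ring.
by rewrite [X in _ + X]exchange_big /= -mulr2n mulr_natl.
Qed.

Lemma sqnorm_ge0 (R : realType) n (v : 'cV[R]_n) : 0 <= sqnorm v.
Proof. by apply: sumr_ge0 => i _; rewrite sqr_ge0. Qed.

(** Cauchy-Schwarz with weights [`|A i j|] bounds each squared entry of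
    [A *m v] by the row sum times [\sum_j `|A i j| * v j 0 ^+ 2]; summing over
    [i] leaves the column sums as coefficients of [v j 0 ^+ 2]. *)
Lemma schur_test (R : realType) m n (A : 'M[R]_(m, n)) (r c : R) :
  row_sums_le A r -> row_sums_le A^T c -> bounded_by (r * c) A.
Proof.
move=> [r0 hr] [c0 hc] v; rewrite /sqnorm.
apply: (@le_trans _ _ (\sum_i r * \sum_j `|A i j| * v j 0 ^+ 2)).
  apply: ler_sum => i _; rewrite mxE.
  apply: (@le_trans _ _ ((\sum_j `|A i j| * `|v j 0|) ^+ 2)).
    rewrite -[X in X <= _]real_normK ?num_real // ler_pXn2r ?nnegrE //.
      apply: le_trans (ler_norm_sum _ _ _) _.
      by apply: ler_sum => j _; rewrite normrM.
    by apply: sumr_ge0 => j _; rewrite mulr_ge0.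
  apply: le_trans (weighted_sum_sqr_le _ _) _ => //.
  under [X in _ * X]eq_bigr do rewrite real_normK ?num_real //.
  apply: ler_wpM2r => //.
  by apply: sumr_ge0 => j _; rewrite mulr_ge0 ?sqr_ge0.
rewrite -mulr_sumr -mulrA ler_wpM2l // exchange_big mulr_sumr /=.
apply: ler_sum => j _; rewrite -mulr_suml ler_wpM2r ?sqr_ge0 //.
by apply: le_trans (hc j); apply: ler_sum => i _; rewrite mxE.
Qed.

Lemma sqnormE (R : realType) n (v : 'cV[R]_n) : sqnorm v = (v^T *m v) 0 0.
Proof. by rewrite mxE; apply: eq_bigr => i _; rewrite mxE expr2. Qed.

Lemma sqnorm_mxcol (R : realType) p (p_ : 'I_p -> nat)
    (v : forall i, 'cV[R]_(p_ i)) :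
  sqnorm (\mxcol_i v i) = \sum_i sqnorm (v i).
Proof.
rewrite sqnormE tr_mxcol mul_mxrow_mxcol summxE.
by apply: eq_bigr => i _; rewrite sqnormE.
Qed.

Lemma bounded_by_mxcol (R : realType) p (p_ : 'I_p -> nat) n (b : R)
    (A : forall i, 'M[R]_(p_ i, n)) :
  (forall i, bounded_by b (A i)) -> bounded_by (p%:R * b) (\mxcol_i A i).
Proof.
move=> hA v; rewrite mxcol_mul sqnorm_mxcol.
apply: le_trans (ler_sum _ (fun i _ => hA i v)) _.
by rewrite sumr_const card_ord -mulrA mulr_natl.
Qed.

Lemma sqnorm_sum_le (R : realType) q n (v : 'I_q -> 'cV[R]_n) :
  sqnorm (\sum_j v j) <= q%:R * \sum_j sqnorm (v j).
Proof.
rewrite /sqnorm exchange_big mulr_sumr /=.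
apply: ler_sum => i _; rewrite summxE.
have := weighted_sum_sqr_le (fun j => v j i 0) (fun j => ler01 : 0 <= 1 :> R).
have E (f : 'I_q -> R) : \sum_j 1 * f j = \sum_j f j.
  by apply: eq_bigr => j _; rewrite mul1r.
by rewrite /= sumr_const card_ord !E.
Qed.

(** Side by side blocks send [v] to a sum of [q] vectors; Cauchy-Schwarz
    on that sum is where the factor [L + 1] of the theorem comes from. *)
Lemma bounded_by_mxrow (R : realType) q (q_ : 'I_q -> nat) m (b : R)
    (A : forall j, 'M[R]_(m, q_ j)) :
  (forall j, bounded_by b (A j)) -> bounded_by (q%:R * b) (\mxrow_j A j).
Proof.
move=> hA v; rewrite -[v]submxcolK mul_mxrow_mxcol sqnorm_mxcol -mulrA.
apply: le_trans (sqnorm_sum_le _) _; rewrite ler_wpM2l // mulr_sumr.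
by apply: ler_sum => j _; apply: hA.
Qed.

Lemma bounded_byW (R : realType) m n (a b : R) (A : 'M[R]_(m, n)) :
  a <= b -> bounded_by a A -> bounded_by b A.
Proof.
by move=> ab hA v; apply: le_trans (hA v) _; rewrite ler_wpM2r ?sqnorm_ge0.
Qed.

(** * Tensor powers with a distinguished factor *)

Lemma tensmx_castr (R : comPzRingType) m n p q p' q' (e : (p = p') * (q = q'))
    (A : 'M[R]_(m, n)) (B : 'M[R]_(p, q)) :
  A *t castmx e B
  = castmx (congr1 (muln m) e.1, congr1 (muln n) e.2) (A *t B).
Proof. by case: e => e1 e2; case: _ / e1; case: _ / e2. Qed.

Lemma tensmx_castl (R : comPzRingType) m n p q m' n' (e : (m = m') * (n = n'))
    (A : 'M[R]_(m, n)) (B : 'M[R]_(p, q)) :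
  castmx e A *t B
  = castmx (congr1 (muln^~ p) e.1, congr1 (muln^~ q) e.2) (A *t B).
Proof. by case: e => e1 e2; case: _ / e1; case: _ / e2. Qed.

Lemma tensmxA (R : comPzRingType) m n p q r s (A : 'M[R]_(m, n))
    (B : 'M[R]_(p, q)) (C : 'M[R]_(r, s)) :
  A *t B *t C = castmx (mulnA m p r, mulnA n q s) (A *t (B *t C)).
Proof.
apply/matrixP => i j; rewrite castmxE !mxE mulrA /=.
congr (A _ _ * B _ _ * C _ _); apply: val_inj => /=.
- by rewrite -divnMA; congr (_ %/ _)%N; rewrite mulnC.
- by rewrite -divnMA; congr (_ %/ _)%N; rewrite mulnC.
- by rewrite modn_divl.
- by rewrite modn_divl.
- by rewrite modn_dvdm ?dvdn_mull.
- by rewrite modn_dvdm ?dvdn_mull.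
Qed.

(** [ntensmx A 1] is [A] itself and not [A *t 1], so the recurrence holds
    only up to a cast of dimensions. *)
Lemma ntensmxS_cast (R : comPzRingType) m n (A : 'M[R]_(m, n)) k
    (e : (m * m ^ k = m ^ k.+1)%N * (n * n ^ k = n ^ k.+1)%N) :
  ntensmx A k.+1 = castmx e (A *t ntensmx A k).
Proof.
case: e => e1 e2; case: k e1 e2 => [|k] e1 e2; last by rewrite castmx_id.
rewrite ntensmx1 ntensmx0 -[X in _ *t X]/(1%:M) tens_mx_scalar scale1r.
by rewrite castmx_comp castmx_id.
Qed.

Lemma ntensmx_split_add (R : comPzRingType) m n (A : 'M[R]_(m, n)) k r
    (e : (m ^ k * (m * m ^ r) = m ^ (k + r.+1))%N *
         (n ^ k * (n * n ^ r) = n ^ (k + r.+1))%N) :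
  ntensmx A (k + r.+1) = castmx e (ntensmx A k *t (A *t ntensmx A r)).
Proof.
case: e => e1 e2; elim: k e1 e2 => [|k IH] e1 e2.
  have ES a : (a * a ^ r = a ^ r.+1)%N by rewrite expnS.
  rewrite ntensmx0 tens_scalar1mx castmx_comp (ntensmxS_cast A (ES m, ES n)).
  by congr (castmx (_, _) _); apply: eq_irrelevance.
have ES a i : (a * a ^ i = a ^ i.+1)%N by rewrite expnS.
have EK a : (a ^ k * (a * a ^ r) = a ^ (k + r.+1))%N by rewrite -expnS -expnD.
rewrite [LHS](@ntensmxS_cast _ _ _ A (k + r.+1) (ES m _, ES n _)).
rewrite (ntensmxS_cast A (ES m k, ES n k)).
rewrite (IH (EK m) (EK n)) tensmx_castr castmx_comp /=.
rewrite tensmx_castl tensmxA !castmx_comp.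
congr (castmx (_, _) _); exact: eq_irrelevance.
Qed.

(** Splits off factor [k] of a tensor power in the shape used by [diff_dir]. *)
Lemma ntensmx_split (R : comPzRingType) m n (A : 'M[R]_(m, n)) d k
    (kd : (k < d)%N)
    (e1 : (m ^ k * (m * m ^ (d - k.+1)) = m ^ d)%N)
    (e2 : (n ^ k * (n * n ^ (d - k.+1)) = n ^ d)%N) :
  ntensmx A d = castmx (e1, e2) (ntensmx A k *t (A *t ntensmx A (d - k.+1))).
Proof.
have [r dE] : {r | d = (k + r.+1)%N}.
  by exists (d - k.+1)%N; rewrite addnS -addSn subnKC.
move: e1 e2; rewrite {d kd}dE addnS -addSn addKn addSn -addnS => e1 e2.
exact: ntensmx_split_add.
Qed.

(** * Prolongation and differences in one dimension *)

(** The shift [a] lets the same bound serve indices that start at [0] and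
    grid points that start at [1]. *)
Lemma sum_eq_addn_le1 (R : realType) n a q :
  \sum_(i < n) ((i + a)%N == q)%:R <= 1 :> R.
Proof.
pose A := [pred i : 'I_n | (i + a)%N == q].
have -> : \sum_(i < n) ((i + a)%N == q)%:R = #|A|%:R :> R.
  rewrite -sum1_card [in RHS]big_mkcond natr_sum /=; apply: eq_bigr => i _.
  by rewrite inE; case: eqP.
rewrite lern1; apply/card_le1_eqP => i j /eqP iq /eqP; rewrite -iq => /addIn.
exact: val_inj.
Qed.

Lemma sum_eq_half_addn_le2 (R : realType) n a q :
  \sum_(i < n) ((i + a)./2 == q)%:R <= 2%:R :> R.
Proof.
apply: (@le_trans _ _ (\sum_(i < n)
    (((i + a)%N == q.*2)%:R + ((i + a)%N == q.*2.+1)%:R))).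
  apply: ler_sum => i _; rewrite -natrD ler_nat.
  move: (i + a)%N => x; case: (x./2 =P q) => // <-.
  rewrite -[X in (X == x./2.*2)]odd_double_half.
  rewrite -[X in (X == x./2.*2.+1)]odd_double_half.
  by case: (odd x); rewrite ?add0n ?add1n eqxx ?addn1.
by rewrite big_split -[2%:R]/(1 + 1) lerD ?sum_eq_addn_le1.
Qed.

(** For even points the two halves [j./2] and [uphalf j] coincide, so that
    one formula covers both cases of the definition. *)
Lemma prol_stepE (R : realType) l i k :
  prol_step R l i k
  = ((k.+1 == i.+1./2)%:R + (k.+1 == uphalf i.+1)%:R) / 2%:R.
Proof.
rewrite mxE; move: i.+1 k.+1 => a q /=; rewrite uphalf_half.
case: (odd a) => //.
by rewrite add0n -mulr2n -[_ *+ 2]mulr_natr mulfK ?pnatr_eq0.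
Qed.

Lemma row_sums_le_prol_step (R : realType) l : row_sums_le (prol_step R l) 1.
Proof.
split=> // i.
under eq_bigr do rewrite prol_stepE ger0_norm ?divr_ge0 ?addr_ge0 //.
rewrite -mulr_suml ler_pdivrMr // mul1r big_split -[2%:R]/(1 + 1) /=.
by apply: lerD; under eq_bigr do rewrite -addn1; apply: sum_eq_addn_le1.
Qed.

Lemma col_sums_le_prol_step (R : realType) l :
  row_sums_le (prol_step R l)^T 2%:R.
Proof.
split=> // k.
under eq_bigr do rewrite mxE prol_stepE ger0_norm ?divr_ge0 ?addr_ge0 //.
rewrite -mulr_suml ler_pdivrMr // mulr_natr mulr2n big_split.
apply: lerD.
  under eq_bigr => i _ do rewrite eq_sym -(addn1 i).
  exact: sum_eq_half_addn_le2.
under eq_bigr => i _ do rewrite eq_sym uphalfE -(addn2 i).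
exact: sum_eq_half_addn_le2.
Qed.

(** Duplicates every entry: fine intervals [2 q] and [2 q + 1] lie in
    coarse interval [q]. *)
Definition repeat2 (R : realType) l : 'M[R]_(2 ^ l.+1, 2 ^ l) :=
  \matrix_(j, q) (j./2 == q)%:R.

Lemma row_sums_le_repeat2 (R : realType) l : row_sums_le (repeat2 R l) 1.
Proof.
split=> // i; under eq_bigr do rewrite mxE normr_nat eq_sym -[X in X == _]addn0.
exact: sum_eq_addn_le1.
Qed.

Lemma col_sums_le_repeat2 (R : realType) l : row_sums_le (repeat2 R l)^T 2%:R.
Proof.
split=> // i; under eq_bigr do rewrite !mxE normr_nat -[X in X./2]addn0.
exact: sum_eq_half_addn_le2.
Qed.

Lemma row_sums_le_diff1d (R : realType) l : row_sums_le (diff1d R l) 2%:R.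
Proof.
split=> // j; apply: (@le_trans _ _ (\sum_(i < npts l)
   (((i + 1)%N == j.+1)%:R + ((i + 1)%N == j)%:R))).
  apply: ler_sum => i _; rewrite mxE addn1.
  by apply: le_trans (ler_normB _ _) _; rewrite !normr_nat.
by rewrite big_split -[2%:R]/(1 + 1) lerD ?sum_eq_addn_le1.
Qed.

Lemma col_sums_le_diff1d (R : realType) l : row_sums_le (diff1d R l)^T 2%:R.
Proof.
split=> // i; apply: (@le_trans _ _ (\sum_(j < 2 ^ l)
   (((j + 1)%N == i.+1)%:R + ((j + 0)%N == i.+1)%:R))).
  apply: ler_sum => j _; rewrite !mxE addn1 addn0 !(eq_sym i.+1).
  by apply: le_trans (ler_normB _ _) _; rewrite !normr_nat.
by rewrite big_split -[2%:R]/(1 + 1) lerD ?sum_eq_addn_le1.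
Qed.

(** Selecting a grid point among the interior ones by a Kronecker delta
    also gives the right value at the two boundary points, provided [f]
    vanishes there. *)
Lemma sum_select (R : realType) n (f : nat -> R) a :
  f 0%N = 0 -> f n.+1 = 0 -> (a <= n.+1)%N ->
  \sum_(i < n) (i.+1 == a)%:R * f i.+1 = f a.
Proof.
case: a => [|a] f0 fn an; first by rewrite big1 ?f0 // => i _; rewrite mul0r.
move: an; rewrite ltnS leq_eqVlt => /orP[/eqP->|an].
  by rewrite big1 // => i _; rewrite eqSS ltn_eqF ?mul0r.
rewrite (bigD1 (Ordinal an)) //= eqxx mul1r big1 ?addr0 // => i.
by rewrite -val_eqE eqSS /= => /negPf->; rewrite mul0r.
Qed.

(** Linear interpolation halves each coarse difference and uses it on both
    fine subintervals. *)
Lemma diff_prol_step (R : realType) l :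
  diff1d R l.+1 *m prol_step R l = 2%:R^-1 *: (repeat2 R l *m diff1d R l).
Proof.
have pow_gt0 a : (0 < 2 ^ a)%N by rewrite expn_gt0.
apply/matrixP => j k; rewrite !mxE.
(* [p i] is the value at the fine point [i], boundary included, of the hat
   function of the coarse point [k.+1]. *)
pose p i : R := ((k.+1 == i./2)%:R + (k.+1 == uphalf i)%:R) / 2%:R.
have p0 : p 0%N = 0 by rewrite /p /= addr0 mul0r.
have kl : (k.+1 < 2 ^ l)%N.
  by have := ltn_ord k; have := pow_gt0 l; rewrite /npts; lia.
have pn : p (npts l.+1).+1 = 0.
  rewrite /npts subn1 prednK // expnS mul2n /p uphalf_double doubleK.
  by rewrite ltn_eqF // addr0 mul0r.
have jl : (j.+1 <= (npts l.+1).+1)%N by rewrite /npts subn1 prednK.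
under eq_bigr do rewrite mxE prol_stepE mulrBl.
rewrite sumrB (@sum_select _ _ p) // (@sum_select _ _ p) 1?ltnW //.
have jh : (j./2 < 2 ^ l)%N.
  by rewrite ltn_half_double -mul2n -expnS.
rewrite (bigD1 (Ordinal jh)) //= !mxE eqxx mul1r.
rewrite big1 ?addr0 => [|q]; last first.
  by rewrite -val_eqE /= eq_sym => /negPf; rewrite mxE => ->; rewrite mul0r.
rewrite /p /= [RHS]mulrC -mulrBl; congr (_ / _).
by rewrite [X in _ - X]addrC opprD addrACA subrr add0r.
Qed.

Lemma sums_le_prol_iter (R : realType) l k :
  row_sums_le (prol_iter R l k) 1 /\
  row_sums_le (prol_iter R l k)^T (2%:R ^+ k).
Proof.
elim: k => [|k [IHr IHc]] /=.
  by rewrite trmx1 expr0; split; apply: row_sums_le1.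
split.
  rewrite -[1]mulr1; apply: row_sums_le_mul => //.
  exact: row_sums_le_prol_step.
rewrite trmx_mul exprSr; apply: row_sums_le_mul => //.
exact: col_sums_le_prol_step.
Qed.

(** Moving [diff1d] through one prolongation step leaves a factor [1 / 2]
    and a duplication, whose row sums are [1] and column sums [2]: the row
    sums halve with each level while the column sums stay at [2]. Bounding
    [diff1d] and [prol_iter] separately would lose this decay. *)
Lemma sums_le_diff_prol_iter (R : realType) l k :
  row_sums_le (diff1d R (k + l) *m prol_iter R l k) (2%:R / 2%:R ^+ k) /\
  row_sums_le (diff1d R (k + l) *m prol_iter R l k)^T 2%:R.
Proof.
elim: k => [|k [IHr IHc]] /=.
  rewrite mulmx1 expr0 divr1; split; first exact: row_sums_le_diff1d.
  exact: col_sums_le_diff1d.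
rewrite mulmxA diff_prol_step -scalemxAl -mulmxA; split.
  rewrite exprS invfM mulrCA; apply: row_sums_leZ; first by rewrite invr_ge0.
  rewrite -[_ / _]mul1r; apply: row_sums_le_mul => //.
  exact: row_sums_le_repeat2.
rewrite linearZ /= trmx_mul.
rewrite -[X in row_sums_le _ X](mulKf (_ : 2%:R != 0)) ?pnatr_eq0 //.
apply: row_sums_leZ; first by rewrite invr_ge0.
by apply: row_sums_le_mul => //; apply: col_sums_le_repeat2.
Qed.

(** * The norm of [C_L S] *)

Lemma sums_le_prol1d (R : realType) L (l : 'I_L.+1) :
  [/\ row_sums_le (prol1d R l) 1, row_sums_le (prol1d R l)^T (2%:R ^+ (L - l)),
      row_sums_le (diff1d R L *m prol1d R l) (2%:R / 2%:R ^+ (L - l))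
    & row_sums_le (diff1d R L *m prol1d R l)^T 2%:R].
Proof.
rewrite /prol1d; move: (L - l)%N (subnK _) => k.
move: (nat_of_ord l) => {}l; case: _ / => /=; rewrite castmx_id.
have [pr pc] := sums_le_prol_iter R l k.
by have [dr dc] := sums_le_diff_prol_iter R l k; split.
Qed.

Lemma mulmx_cast_inner (R : pzRingType) m n n' p p' (en : n = n') (ep : p = p')
    (A : 'M[R]_(m, n)) (B : 'M[R]_(n, p)) :
  castmx (erefl, en) A *m castmx (en, ep) B = castmx (erefl, ep) (A *m B).
Proof. by case: _ / en; case: _ / ep. Qed.

Lemma ntensmx_mul (R : comPzRingType) m n p (A : 'M[R]_(m, n))
    (B : 'M[R]_(n, p)) k :
  ntensmx A k *m ntensmx B k = ntensmx (A *m B) k.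
Proof.
case: k => [|k]; first exact: mulmx1.
by rewrite /ntensmx; elim: k => [//|k IH] /=; rewrite tensmx_mul IH.
Qed.

Lemma trmx_ntens (R : pzRingType) m n (A : 'M[R]_(m, n)) k :
  (ntensmx A k)^T = ntensmx A^T k.
Proof.
case: k => [|k]; first exact: trmx1.
by rewrite /ntensmx; elim: k => [//|k IH] /=; rewrite trmx_tens IH.
Qed.

(** Only the factor in direction [k] carries the decay [1 / w] of the row
    sums; the [d.-1] other factors contribute [w] each to the column sums. *)
Lemma sums_le_diff_dir_prol (R : realType) d L (k : 'I_d) (l : 'I_L.+1)
    (w := 2%:R ^+ (L - l)) :
  row_sums_le (diff_dir R L k *m prol R d l) (2%:R / w) /\
  row_sums_le (diff_dir R L k *m prol R d l)^T (2%:R * w ^+ d.-1).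
Proof.
have [pr pc dr dc] := sums_le_prol1d R l.
have split := ntensmx_split (prol1d R l) (ltn_ord k) (tens_dim _ (ltn_ord k))
  (tens_dim _ (ltn_ord k)).
rewrite /prol split /diff_dir mulmx_cast_inner !tensmx_mul !ntensmx_mul !mul1mx.
split.
  have pk i : row_sums_le (ntensmx (prol1d R l) i) 1.
    by have := row_sums_le_ntens i pr; rewrite expr1n.
  apply: row_sums_le_cast; rewrite -[_ / _]mul1r; apply: row_sums_le_tens => //.
  by rewrite -[_ / _]mulr1; apply: row_sums_le_tens.
rewrite trmx_cast !trmx_tens !trmx_ntens; apply: row_sums_le_cast.
have -> : 2%:R * w ^+ d.-1 = w ^+ k * (2%:R * w ^+ (d - k.+1)).
  rewrite mulrCA -exprD; congr (_ * _ ^+ _).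
  by have := ltn_ord k; lia.
apply: row_sums_le_tens; first exact: row_sums_le_ntens.
by apply: row_sums_le_tens => //; apply: row_sums_le_ntens.
Qed.

(** The scalings of [C_L] and [S_l] multiply to [w ^ (1 - d / 2)]. The
    square is multiplied by [w ^+ d] here because [2 - d] can be negative. *)
Lemma scaling_sqr (R : realType) d L l (w := 2%:R ^+ (L - l) : R) :
  (l <= L)%N ->
  (meshsize R L `^ (d%:R / 2%:R - 1)
   * meshsize R l `^ ((2%:R - d%:R) / 2%:R)) ^+ 2 * w ^+ d = w ^+ 2.
Proof.
move=> lL; rewrite /meshsize -!exprVn.
have -> : 2%:R^-1 ^+ L = w^-1 * 2%:R^-1 ^+ l :> R.
  by rewrite /w -exprVn -exprD subnK.
have w0 : 0 < w by rewrite exprn_gt0.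
set h := _^-1 ^+ l; have h0 : 0 < h by rewrite exprn_gt0 ?invr_gt0.
set a := d%:R / 2%:R - 1.
have -> : (2%:R - d%:R) / 2%:R = - a by rewrite /a; field.
rewrite powRM ?invr_ge0 ?ltW // powRN mulfK; last first.
  by rewrite gt_eqF ?powR_gt0.
have wi : 0 < w^-1 by rewrite invr_gt0.
rewrite -powR_mulrn ?powR_ge0 // -powRrM.
have -> : a * 2%:R = d%:R - 2%:R by rewrite /a; field.
have -> : w^-1 `^ (d%:R - 2%:R) = w^-1 `^ d%:R * w^-1 `^ (- 2%:R).
  by rewrite powRD // (gt_eqF wi) implybT.
rewrite powRN !powR_mulrn ?ltW // !exprVn invrK.
by rewrite mulrAC mulVf ?mul1r // gt_eqF // exprn_gt0.
Qed.

Lemma mxcolZ (R : pzRingType) p (p_ : 'I_p -> nat) n (a : R)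
    (A : forall i, 'M[R]_(p_ i, n)) :
  a *: (\mxcol_i A i) = \mxcol_i (a *: A i).
Proof. by apply/matrixP => i j; rewrite !mxE. Qed.

Lemma bounded_by_level (R : realType) d L (l : 'I_L.+1) : (1 <= d)%N ->
  bounded_by (d%:R * 4%:R) (Cmat R d L *m Slevel R d l).
Proof.
move=> d1; rewrite /Cmat /Slevel /diff_op -scalemxAl -scalemxAr scalerA.
rewrite mxcol_mul mxcolZ; apply: bounded_by_mxcol => k.
have [dr dc] := sums_le_diff_dir_prol R k l.
set s := _ * _; set w : R := 2%:R ^+ (L - l) in dr dc *.
have s0 : 0 <= s by rewrite mulr_ge0 ?powR_ge0.
have w0 : w != 0 by rewrite expf_neq0 ?pnatr_eq0.
apply: bounded_byW (schur_test (row_sums_leZ s0 dr) _); last first.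
  by rewrite linearZ; apply: row_sums_leZ s0 dc.
have sE : s ^+ 2 * w ^+ d = w ^+ 2 by apply: scaling_sqr; rewrite -ltnS.
have -> : s * (2%:R / w) * (s * (2%:R * w ^+ d.-1))
    = 4%:R * (s ^+ 2 * (w * w ^+ d.-1)) / w ^+ 2 by field.
by rewrite -exprS prednK // sE mulfK ?lexx // expf_neq0.
Qed.

Lemma bounded_by_CS (R : realType) d L : (1 <= d)%N ->
  bounded_by (L.+1%:R * (d%:R * 4%:R)) (Cmat R d L *m Smat R d L).
Proof.
by move=> d1; rewrite /Smat mul_mxrow; apply: bounded_by_mxrow => l;
  apply: bounded_by_level.
Qed.

(** * Square roots of positive semidefinite matrices *)

Lemma adjmxM (C : numClosedFieldType) m n p (A : 'M[C]_(m, n))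
    (B : 'M[C]_(n, p)) :
  (A *m B)^t* = B^t* *m A^t*.
Proof. by rewrite trmx_mul map_mxM. Qed.

Lemma adjmxB (C : numClosedFieldType) m n (A B : 'M[C]_(m, n)) :
  (A - B)^t* = A^t* - B^t*.
Proof. by rewrite linearB /= map_mxB. Qed.

Definition psd (C : numClosedFieldType) n (X : 'M[C]_n) : Prop :=
  X^t* = X /\ forall v : 'cV_n, 0 <= (v^t* *m X *m v) 0 0.

Definition sqrtmx (C : numClosedFieldType) n (X : 'M[C]_n) : 'M[C]_n :=
  (spectralmx X)^t* *m diag_mx (map_mx sqrtC (spectral_diag X)) *m spectralmx X.

Lemma psd_spectral (C : numClosedFieldType) n (X : 'M[C]_n) : psd X ->
  X = (spectralmx X)^t* *m diag_mx (spectral_diag X) *m spectralmx X.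
Proof.
move=> [Xh _]; rewrite -invmx_unitary ?spectral_unitarymx //.
apply/orthomx_spectralP/hermitian_normalmx/is_hermitianmxP.
by rewrite expr0 scale1r Xh.
Qed.

Lemma spectralmx_mul_adj (C : numClosedFieldType) n (X : 'M[C]_n) :
  spectralmx X *m (spectralmx X)^t* = 1%:M.
Proof. exact/unitarymxP/spectral_unitarymx. Qed.

Lemma spectralmx_adj_mul (C : numClosedFieldType) n (X : 'M[C]_n) :
  (spectralmx X)^t* *m spectralmx X = 1%:M.
Proof. exact/mulmx1C/spectralmx_mul_adj. Qed.

Lemma psd_spectral_diag_ge0 (C : numClosedFieldType) n (X : 'M[C]_n) i :
  psd X -> 0 <= spectral_diag X 0 i.
Proof.
move=> Xpsd; have [_ X0] := Xpsd.
have := X0 ((spectralmx X)^t* *m delta_mx i 0).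
move: (spectralmx_mul_adj X) (psd_spectral Xpsd).
move: (spectralmx X) (spectral_diag X) => P D PP ->.
rewrite adjmxM trmxCK !mulmxA.
do 2! rewrite -(mulmxA _ P (P^t*)) PP mulmx1.
rewrite trmx_delta map_delta_mx -rowE mxE.
rewrite (bigD1 i) //= big1 ?addr0 => [|j ji]; rewrite !mxE !eqxx ?mulr1 //.
by rewrite (negPf ji) mulr0.
Qed.

Lemma sqrtmx_sqr (C : numClosedFieldType) n (X : 'M[C]_n) : psd X ->
  sqrtmx X *m sqrtmx X = X.
Proof.
move=> Xpsd; rewrite [RHS]psd_spectral // /sqrtmx !mulmxA.
rewrite -(mulmxA _ (spectralmx X) (_^t*)) spectralmx_mul_adj mulmx1.
congr (_ *m _); rewrite -mulmxA mulmx_diag; congr (_ *m diag_mx _).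
by apply/rowP => j; rewrite !mxE -expr2 sqrtCK.
Qed.

Lemma sqrtmx_adj (C : numClosedFieldType) n (X : 'M[C]_n) : psd X ->
  (sqrtmx X)^t* = sqrtmx X.
Proof.
move=> Xpsd; rewrite /sqrtmx !adjmxM trmxCK mulmxA tr_diag_mx map_diag_mx.
congr (_ *m diag_mx _ *m _); apply/rowP => j; rewrite !mxE.
by apply/CrealP/ger0_real; rewrite sqrtC_ge0 psd_spectral_diag_ge0.
Qed.

(** Entrywise, the hypothesis says that [a 0 i = b 0 j] wherever [B i j]
    is nonzero, and then the square roots agree too. *)
Lemma diag_mx_sqrtC_intertwine (C : numClosedFieldType) m n
    (a : 'rV[C]_m) (b : 'rV[C]_n) (B : 'M[C]_(m, n)) :
  diag_mx a *m B = B *m diag_mx b ->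
  diag_mx (map_mx sqrtC a) *m B = B *m diag_mx (map_mx sqrtC b).
Proof.
move=> /matrixP E; apply/matrixP => i j; have := E i j.
rewrite !mul_diag_mx !mul_mx_diag !mxE => e.
have [->|B0] := eqVneq (B i j) 0; first by rewrite mulr0 mul0r.
have -> : a 0 i = b 0 j by apply: (mulIf B0); rewrite e mulrC.
by rewrite mulrC.
Qed.

(** In the spectral bases of [X] and [Y] this is
    [diag_mx_sqrtC_intertwine]. *)
Lemma sqrtmx_intertwine (C : numClosedFieldType) m n (X : 'M[C]_m)
    (Y : 'M[C]_n) (B : 'M[C]_(m, n)) :
  psd X -> psd Y -> X *m B = B *m Y -> sqrtmx X *m B = B *m sqrtmx Y.
Proof.
move=> Xpsd Ypsd; rewrite /sqrtmx.
move: (spectralmx_mul_adj X) (spectralmx_adj_mul X) (psd_spectral Xpsd).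
move: (spectralmx_mul_adj Y) (spectralmx_adj_mul Y) (psd_spectral Ypsd).
move: (spectralmx X) (spectral_diag X) (spectralmx Y) (spectral_diag Y).
move=> P a Q b QQ' Q'Q YE PP' P'P XE XBY.
have : diag_mx a *m (P *m B *m Q^t*) = (P *m B *m Q^t*) *m diag_mx b.
  transitivity (P *m (X *m B) *m Q^t*).
    by rewrite XE !mulmxA PP' mul1mx.
  by rewrite XBY YE !mulmxA -(mulmxA _ Q (Q^t*)) QQ' mulmx1.
move=> /diag_mx_sqrtC_intertwine /(congr1 (mulmx (P^t*))).
move=> /(congr1 (mulmx^~ Q)); rewrite !mulmxA P'P mul1mx.
by rewrite -(mulmxA _ (Q^t*) Q) Q'Q mulmx1.
Qed.

Lemma halmos_unitary (C : numClosedFieldType) n (M : 'M[C]_n)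
    (S := sqrtmx (1%:M - M^t* *m M)) (S' := sqrtmx (1%:M - M *m M^t*)) :
  psd (1%:M - M^t* *m M) -> psd (1%:M - M *m M^t*) ->
  block_mx M S' S (- M^t*) \is unitarymx.
Proof.
move=> p p'; apply/unitarymxP.
have Sa : S^t* = S := sqrtmx_adj p.
have Sa' : S'^t* = S' := sqrtmx_adj p'.
have SM : S' *m M = M *m S.
  apply: sqrtmx_intertwine => //.
  by rewrite mulmxBl mulmxBr mul1mx mulmx1 mulmxA.
have SM' : S *m M^t* = M^t* *m S'.
  by rewrite -[in LHS]Sa -[in RHS]Sa' -!adjmxM SM.
have adjN : (- M^t*)^t* = - M by rewrite linearN /= map_mxN trmxCK.
rewrite tr_block_mx map_block_mx Sa Sa' adjN mulmx_block.
rewrite /S /S' !sqrtmx_sqr // -/S -/S' !mulmxN !mulNmx SM SM' opprK.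
by rewrite addrC subrK !subrr subrK -scalar_mx_block.
Qed.

(** * Norm bounds over the complex numbers *)

Definition csqnorm (R : realType) n (v : 'cV[R[i]]_n) : R :=
  \sum_j Normc.normc (v j 0) ^+ 2.

Definition cbounded_by (R : realType) m n (b : R) (M : 'M[R[i]]_(m, n)) :
    Prop :=
  forall v, csqnorm (M *m v) <= b * csqnorm v.

Lemma csqnorm_ge0 (R : realType) n (v : 'cV[R[i]]_n) : 0 <= csqnorm v.
Proof. by apply: sumr_ge0 => j _; rewrite sqr_ge0. Qed.

Lemma csqnormE (R : realType) n (v : 'cV[R[i]]_n) :
  (csqnorm v)%:C = (v^t* *m v) 0 0.
Proof.
rewrite mxE raddf_sum /=; apply: eq_bigr => j _.
by rewrite !mxE mulrC -normCK -rmorphXn.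
Qed.

Lemma csqnorm_ReIm (R : realType) n (v : 'cV[R[i]]_n) :
  csqnorm v
  = sqnorm (map_mx (@complex.Re R) v) + sqnorm (map_mx (@complex.Im R) v).
Proof.
rewrite /csqnorm /sqnorm -big_split; apply: eq_bigr => j _ /=.
rewrite !mxE; case: (v j 0) => a b /=.
by rewrite sqr_sqrtr // addr_ge0 ?sqr_ge0.
Qed.

(** A real matrix acts separately on real and imaginary parts. *)
Lemma cbounded_by_complexify (R : realType) m n (b : R) (A : 'M[R]_(m, n)) :
  bounded_by b A -> cbounded_by b (complexify A).
Proof.
move=> hA v; rewrite !csqnorm_ReIm mulrDr.
have -> : map_mx (@complex.Re R) (complexify A *m v)
    = A *m map_mx (@complex.Re R) v.
  apply/matrixP => i j; rewrite !mxE raddf_sum; apply: eq_bigr => k _.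
  by rewrite !mxE; case: (v k j) => x y /=; rewrite mul0r subr0.
have -> : map_mx (@complex.Im R) (complexify A *m v)
    = A *m map_mx (@complex.Im R) v.
  apply/matrixP => i j; rewrite !mxE raddf_sum; apply: eq_bigr => k _.
  by rewrite !mxE; case: (v k j) => x y /=; rewrite mul0r addr0.
by rewrite lerD.
Qed.

Lemma cbounded_by_mul (R : realType) m n p (a b : R) (A : 'M[R[i]]_(m, n))
    (B : 'M[R[i]]_(n, p)) :
  0 <= a -> cbounded_by a A -> cbounded_by b B -> cbounded_by (a * b) (A *m B).
Proof.
move=> a0 hA hB v; rewrite -mulmxA -mulrA.
by apply: le_trans (hA _) _; rewrite ler_wpM2l.
Qed.

Lemma csqnormZ (R : realType) n (a : R) (v : 'cV[R[i]]_n) :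
  csqnorm (a%:C *: v) = a ^+ 2 * csqnorm v.
Proof.
rewrite /csqnorm mulr_sumr; apply: eq_bigr => j _.
rewrite mxE; case: (v j 0) => x y /=.
rewrite !sqr_sqrtr ?addr_ge0 ?sqr_ge0 //; ring.
Qed.

Lemma cbounded_byZ (R : realType) m n (a b : R) (M : 'M[R[i]]_(m, n)) :
  cbounded_by b M -> cbounded_by (a ^+ 2 * b) (a%:C *: M).
Proof.
move=> hM v; rewrite -scalemxAl csqnormZ -mulrA.
by rewrite ler_wpM2l ?sqr_ge0.
Qed.

Lemma cbounded_by_pid (R : realType) m n r :
  cbounded_by 1 (pid_mx r : 'M[R[i]]_(m, n)).
Proof.
have -> : pid_mx r = complexify (pid_mx r) :> 'M[R[i]]_(m, n).
  by rewrite /complexify map_pid_mx.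
apply: cbounded_by_complexify.
have h k l : row_sums_le (pid_mx r : 'M[R]_(k, l)) 1.
  split=> // i; under eq_bigr do rewrite mxE normr_nat.
  have [il|il] := ltnP i l; last first.
    rewrite big1 // => j _; case: eqP => // ij.
    by move: (ltn_ord j); rewrite -ij ltnNge il.
  rewrite (bigD1 (Ordinal il)) //= eqxx big1 ?addr0 ?lern1 ?leq_b1 // => j.
  by rewrite -val_eqE /= eq_sym => /negPf ->.
by rewrite -[1]mulr1; apply: schur_test; rewrite ?tr_pid_mx.
Qed.

(** With [u = M^* v], expanding [0 <= csqnorm (b v - M u)] gives
    [2 b |u|^2 <= b^2 |v|^2 + |M u|^2 <= b^2 |v|^2 + b |u|^2]. *)
Lemma cbounded_by_adj (R : realType) m n (b : R) (M : 'M[R[i]]_(m, n)) :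
  0 < b -> cbounded_by b M -> cbounded_by b (M^t*).
Proof.
move=> b0 hM v.
set u := M^t* *m v; have := hM u.
have : csqnorm (b%:C *: v - M *m u)
    = b ^+ 2 * csqnorm v - 2%:R * b * csqnorm u + csqnorm (M *m u).
  apply: (fmorph_inj (real_complex R)).
  rewrite !(rmorphD, rmorphN, rmorphM, rmorphXn, rmorph_nat) /=.
  have e1 : v^t* *m (M *m u) = u^t* *m u by rewrite mulmxA /u adjmxM trmxCK.
  have e2 : (M *m u)^t* *m v = u^t* *m u by rewrite adjmxM -mulmxA.
  rewrite !csqnormE adjmxB mulmxBr !mulmxBl.
  have -> : (b%:C *: v)^t* = b%:C *: v^t*.
    by rewrite linearZ /= map_mxZ /=; congr (_ *: _); exact: conjc_real.
  rewrite -!scalemxAl -!scalemxAr e1 e2.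
  rewrite !mxE; ring.
have := csqnorm_ge0 (b%:C *: v - M *m u).
move=> + E; rewrite E => h1 h2.
rewrite -(ler_pM2l b0); nra.
Qed.

(** The quadratic form of [1 - M^* M] at [v] is
    [csqnorm v - csqnorm (M *m v)]. *)
Lemma psd_1B_adj_mul (R : realType) m n (M : 'M[R[i]]_(m, n)) :
  cbounded_by 1 M -> psd (1%:M - M^t* *m M).
Proof.
move=> hM; split=> [|v].
  by rewrite adjmxB adjmxM trmxCK trmx1 map_mx1.
have -> : v^t* *m (1%:M - M^t* *m M) *m v = v^t* *m v - (M *m v)^t* *m (M *m v).
  by rewrite adjmxM mulmxBr mulmxBl mulmx1 !mulmxA.
rewrite mxE [X in _ + X]mxE -!csqnormE -rmorphB lecR subr_ge0.
by have := hM v; rewrite mul1r.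
Qed.

Lemma opnorm_le (R : realType) m n (g : R) (M : 'M[R[i]]_(m, n)) :
  0 <= g -> cbounded_by (g ^+ 2) M -> opnorm M <= g.
Proof.
move=> g0 hM; apply: ge_sup.
  exists (l2norm (M *m 0)); exists 0 => //=.
  rewrite /l2norm big1 ?sqrtr0 // => j _.
  by rewrite mxE /= expr0n /= addr0 sqrtr0 expr0n.
move=> _ [v /= v1 <-]; rewrite -[g]ger0_norm // -sqrtr_sqr ler_wsqrtr //.
apply: le_trans (hM v) _; rewrite ler_piMr ?sqr_ge0 //.
by move: v1; rewrite /l2norm -[X in _ <= X]sqrtr1 ler_sqrt.
Qed.

(** * Dilations and block-encodings *)

(** With one ancilla qubit, the projection on the ancilla state 0 selects
    the upper half of the coordinates, so block-encodings are the upper left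
    blocks of two-by-two block matrices. *)
Lemma ancilla_projE (R : realType) n (e : (2 ^ n + 2 ^ n = 2 ^ 1 * 2 ^ n)%N) :
  ancilla_proj R 1 n = castmx (erefl, e) (row_mx 1%:M 0).
Proof.
apply/matrixP => i j; rewrite !castmxE !mxE -!val_eqE /= modn_small //.
have pow_gt0 : (0 < 2 ^ n)%N by rewrite expn_gt0.
case: splitP => k /= jk; rewrite !mxE jk -?val_eqE /=.
  by rewrite divn_small // modn_small // mul1r.
by rewrite divnDl // divnn pow_gt0 mul0r.
Qed.

Lemma contraction_dilation (R : realType) n (M : 'M[R[i]]_(2 ^ n)) :
  cbounded_by 1 M ->
  exists2 U : 'M[R[i]]_(2 ^ 1 * 2 ^ n), U \is unitarymx &
    ancilla_proj R 1 n *m U *m (ancilla_proj R 1 n)^t* = M.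
Proof.
move=> hM.
have e : (2 ^ n + 2 ^ n = 2 ^ 1 * 2 ^ n)%N by rewrite mul2n addnn.
have p := psd_1B_adj_mul hM.
have := psd_1B_adj_mul (cbounded_by_adj ltr01 hM); rewrite trmxCK => p'.
have Uu := halmos_unitary p p'.
exists (castmx (e, e) (block_mx M (sqrtmx (1%:M - M *m M^t*))
  (sqrtmx (1%:M - M^t* *m M)) (- M^t*))).
  by move: (block_mx _ _ _ _) Uu; case: _ / e.
rewrite ancilla_projE; case: _ / e; rewrite !castmx_id.
rewrite tr_row_mx map_col_mx mul_row_block mul_row_col !trmx1 map_mx1.
by rewrite trmx0 map_mx0 !mul1mx !mul0mx !addr0 mulmx1 mulmx0 addr0.
Qed.

(** Padding with zeros to size [2 ^ n] and dividing by [g] gives a square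
    contraction; both kinds of block-encoding are read off its dilation. *)
Lemma padded_dilation (R : realType) m1 m2 n (g : R) (K : 'M[R[i]]_(m2, m1)) :
  0 < g -> cbounded_by (g ^+ 2) K ->
  exists2 U : 'M[R[i]]_(2 ^ 1 * 2 ^ n), U \is unitarymx &
    g%:C *: (ancilla_proj R 1 n *m U *m (ancilla_proj R 1 n)^t*)
    = pid_mx m2 *m K *m pid_mx m1.
Proof.
move=> g0 hK; set P := pid_mx m2 *m K *m pid_mx m1.
have hP : cbounded_by (1 * (g ^+ 2) * 1) P.
  apply: cbounded_by_mul; first by rewrite mul1r sqr_ge0.
    by apply: cbounded_by_mul => //; apply: cbounded_by_pid.
  exact: cbounded_by_pid.
have [|U Uu UE] := @contraction_dilation R n ((g^-1)%:C *: P).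
  have := cbounded_byZ g^-1 hP.
  by rewrite mul1r mulr1 -exprMn mulVf ?gt_eqF // expr1n.
exists U => //; rewrite UE scalerA -rmorphM mulfV ?gt_eqF //.
by rewrite scale1r.
Qed.

Lemma opnorm_subrr (R : realType) m n (M : 'M[R[i]]_(m, n)) :
  opnorm (M - M) <= 0.
Proof.
rewrite subrr; apply: opnorm_le => // v.
rewrite mul0mx expr0n mul0r /csqnorm big1 // => j _.
by rewrite mxE /= expr0n /= addr0 sqrtr0 expr0n.
Qed.

Lemma exists_block_encoding (R : realType) N (g : R) (M : 'M[R[i]]_N) :
  0 < g -> cbounded_by (g ^+ 2) M ->
  exists m n (U : 'M[R[i]]_(2 ^ m * 2 ^ n)), block_encoding g 0 U M.
Proof.
move=> g0 hM; have [U Uu UE] := padded_dilation N g0 hM.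
exists 1%N, N, U; split=> //; first exact: ltnW (ltn_expl _ _).
  by rewrite UE opnorm_subrr.
exact: opnorm_le (ltW g0) hM.
Qed.

Lemma ancilla_proj_unitary (R : realType) n : ancilla_proj R 1 n \is unitarymx.
Proof.
have e : (2 ^ n + 2 ^ n = 2 ^ 1 * 2 ^ n)%N by rewrite mul2n addnn.
rewrite ancilla_projE; case: _ / e; rewrite castmx_id; apply/unitarymxP.
rewrite tr_row_mx map_col_mx mul_row_col trmx1 map_mx1.
by rewrite mul1mx mul0mx addr0.
Qed.

Lemma pid_mx_adj (C : numClosedFieldType) m n r :
  (pid_mx r : 'M[C]_(m, n))^t* = pid_mx r.
Proof. by rewrite tr_pid_mx map_pid_mx. Qed.

Lemma pid_mx_coisometry (R : nzRingType) m n : (m <= n)%N ->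
  (pid_mx m : 'M[R]_(m, n)) *m (pid_mx m : 'M_(n, m)) = 1%:M.
Proof. by move=> mn; rewrite pid_mx_id // pid_mx_1. Qed.

(** The dimension [p] is a variable because the dilation lives in dimension
    [2 ^ 1 * 2 ^ n], which is only propositionally a power of two. *)
Lemma gen_block_encoding_of_dim (R : realType) M1 M2 (g : R) p m
    (e : p = (2 ^ m)%N)
    (P1 : 'M[R[i]]_(M1, p)) (P2 : 'M[R[i]]_(M2, p)) (U : 'M[R[i]]_p)
    (K : 'M[R[i]]_(M2, M1)) :
  (M1 <= p)%N -> (M2 <= p)%N ->
  P1 \is unitarymx -> P2 \is unitarymx -> U \is unitarymx -> 0 < g ->
  g%:C *: (P2 *m U *m P1^t*) = K ->
  exists m Pi1 Pi2 (U : 'M[R[i]]_(2 ^ m)), gen_block_encoding g 0 Pi1 Pi2 U K.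
Proof.
move=> h1 h2 u1 u2 uu g0 KE; subst p; exists m, P1, P2, U; split=> //.
  by rewrite h1 h2.
by rewrite KE opnorm_subrr.
Qed.

(** The projections keep ancilla 0 and then the first [M1], resp. [M2],
    coordinates, which undoes the padding. *)
Lemma exists_gen_block_encoding (R : realType) M1 M2 (g : R)
    (K : 'M[R[i]]_(M2, M1)) :
  0 < g -> cbounded_by (g ^+ 2) K ->
  exists m Pi1 Pi2 (U : 'M[R[i]]_(2 ^ m)), gen_block_encoding g 0 Pi1 Pi2 U K.
Proof.
move=> g0 hK; pose n := (M1 + M2)%N.
have le1 : (M1 <= 2 ^ n)%N.
  by apply: leq_trans (leq_addr _ _) (ltnW (ltn_expl _ _)).
have le2 : (M2 <= 2 ^ n)%N.
  by apply: leq_trans (leq_addl _ _) (ltnW (ltn_expl _ _)).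
have [U Uu UE] := padded_dilation n g0 hK.
have Pu M : (M <= 2 ^ n)%N ->
  (pid_mx M : 'M_(M, 2 ^ n)) *m ancilla_proj R 1 n \is unitarymx.
  move=> le; apply: mul_unitarymx (ancilla_proj_unitary R n).
  by apply/unitarymxP; rewrite pid_mx_adj pid_mx_coisometry.
have leM M : (M <= 2 ^ n -> M <= 2 ^ 1 * 2 ^ n)%N.
  by move=> le; rewrite (leq_trans le) // leq_pmull.
apply: (gen_block_encoding_of_dim (esym (expnD 2 1 n)) (leM _ le1) (leM _ le2)
  (Pu _ le1) (Pu _ le2) Uu g0).
rewrite adjmxM pid_mx_adj.
have -> (A : 'M_(M2, 2 ^ n)) B V (D : 'M_(2 ^ n, M1)) :
  A *m B *m V *m (B^t* *m D) = A *m (B *m V *m B^t*) *m D.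
  by rewrite !mulmxA.
rewrite scalemxAl scalemxAr UE !mulmxA pid_mx_coisometry // mul1mx.
by rewrite -mulmxA pid_mx_coisometry // mulmx1.
Qed.

Lemma complexify_gram (R : realType) m n (K : 'M[R]_(m, n)) :
  complexify (K^T *m K) = (complexify K)^t* *m complexify K.
Proof.
rewrite /complexify map_mxM; congr (_ *m _).
by apply/matrixP => i j; rewrite !mxE; apply/esym/conjc_real.
Qed.

Theorem theorem4p2 (R : realType) :
  exists2 c : R, 0 < c &
  forall d L : nat, (1 <= d)%N ->
    precondA R d L = (Cmat R d L *m Smat R d L)^T *m (Cmat R d L *m Smat R d L)
    /\ exists alphaCS : R,
      [/\ exists m Pi1 Pi2 (U : 'M[R[i]]_(2 ^ m)),
            gen_block_encoding alphaCS 0 Pi1 Pi2 U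
              (complexify (Cmat R d L *m Smat R d L)),
          exists m n (U : 'M[R[i]]_(2 ^ m * 2 ^ n)),
            block_encoding (alphaCS ^+ 2) 0 U (complexify (precondA R d L))
        & alphaCS ^+ 2 <= c * (d%:R ^+ 2 * L.+1%:R)].
Proof.
exists 4%:R => // d L d1.
have gram : precondA R d L =
    (Cmat R d L *m Smat R d L)^T *m (Cmat R d L *m Smat R d L).
  by rewrite /precondA /Amat trmx_mul !mulmxA.
split=> //; set K := Cmat R d L *m Smat R d L in gram *.
set b : R := L.+1%:R * (d%:R * 4%:R).
have b0 : 0 < b by rewrite !mulr_gt0 ?ltr0n.
have hK : cbounded_by b (complexify K).
  by apply: cbounded_by_complexify; apply: bounded_by_CS.
have sqrtb : Num.sqrt b ^+ 2 = b by rewrite sqr_sqrtr ?ltW.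
exists (Num.sqrt b); split.
- by apply: exists_gen_block_encoding; rewrite ?sqrtr_gt0 ?sqrtb.
- rewrite sqrtb gram complexify_gram; apply: exists_block_encoding => //.
  by apply: cbounded_by_mul (ltW b0) (cbounded_by_adj b0 hK) hK.
- rewrite sqrtb [b]mulrC [d%:R * _]mulrC -mulrA ler_wpM2l // ler_wpM2r //.
  by rewrite expr2 ler_peMr // ler1n.
Qed.
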